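(* Let $\rho$ be a measure on $(\mathbb{R},\mathcal{B}(\mathbb{R}))$ (finite or $\sigma$-finite) with all moments finite and $\rho(\{0\})=0$, let $\sigma$ be a non-atomic Radon measure on $\mathbb{R}^d$, let $d\widehat\sigma(s,x)=d\rho(s)\,d\sigma(x)$ on $\mathbb{R}^{d+1}=\mathbb{R}\times\mathbb{R}^d$, and let $\widehat\varphi\in\mathcal{D}(\mathbb{R}^{d+1})$. For any $h\in\mathcal{F}C_b^\infty(\mathcal{D},\Omega)$ the operator $U_\Sigma^{-1}\nabla^{P}_{\widehat\varphi}U_\Sigma$ has the following form: $$\big(U_\Sigma^{-1}\nabla^{P}_{\widehat\varphi}U_\Sigma h\big)(\omega)=\int_{\mathbb{R}^d}\int_{\mathbb{R}}\big(h(\omega+s\varepsilon_x)-h(\omega)\big)\,\widehat\varphi(s,x)\,d\rho(s)\,d\sigma(x).$$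
   Context: $\mathcal{D}(\mathbb{R}^k)=C_0^\infty(\mathbb{R}^k)$, $\mathcal{D}=\mathcal{D}(\mathbb{R}^d)$, $\mathcal{D}'$ is the dual of $\mathcal{D}$, $\langle\cdot,\cdot\rangle$ is the dual pairing, and $\varepsilon_x$ is the Dirac measure at $x$. Moments of $\rho$ are the integrals of $|s|^n$, $n\ge1$. Configurations: $\Gamma_{\mathbb{R}^{d+1}}$ is the set of all locally finite subsets $\widehat\gamma$ of $\mathbb{R}^{d+1}$ (finite intersection with every compact set), each identified with the measure $\sum_{\widehat x\in\widehat\gamma}\varepsilon_{\widehat x}$; write $\widehat x=(s,x)\in\mathbb{R}\times\mathbb{R}^d$. $\pi_{\widehat\sigma}$ is the Poisson measure on $\Gamma_{\mathbb{R}^{d+1}}$ with intensity $\widehat\sigma$, with Laplace transform $\int e^{\langle\widehat\gamma,\widehat\psi\rangle}\,d\pi_{\widehat\sigma}(\widehat\gamma)=\exp\big(\int_{\mathbb{R}^{d+1}}(e^{\widehat\psi(\widehat x)}-1)\,d\widehat\sigma(\widehat x)\big)$, $\widehat\psi\in\mathcal{D}(\mathbb{R}^{d+1})$. It is concentrated on $\widehat\Gamma$, the set of those $\widehat\gamma=\sum_i\varepsilon_{(s_i,x_i)}\in\Gamma_{\mathbb{R}^{d+1}}$ with $x_i\ne x_j$ for $i\ne j$. Compound Poisson space: $\mu_{CP}$ is the measure on $\mathcal{D}'$ with Laplace transform $\int e^{\langle\omega,\varphi\rangle}\,d\mu_{CP}(\omega)=\exp\big(\int_{\mathbb{R}^d}\int_{\mathbb{R}}(e^{s\varphi(x)}-1)\,d\rho(s)\,d\sigma(x)\big)$,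 $\varphi\in\mathcal{D}$. It has full measure on $\Omega$, the set of those $\sum_{x\in\gamma}s_x\varepsilon_x\in\mathcal{D}'$ with $s_x\in\mathrm{supp}\,\rho$, where $\gamma\subset\mathbb{R}^d$ is locally finite if $\rho(\mathbb{R})<\infty$ and locally countable if $\rho(\mathbb{R})=\infty$. It is the image of $\pi_{\widehat\sigma}$ under the map $\Sigma:\widehat\Gamma\to\Sigma\widehat\Gamma=\Omega\subset\mathcal{D}'$, $\Sigma\widehat\gamma=\sum_{(s_i,x_i)\in\widehat\gamma}s_i\varepsilon_{x_i}$, which has an inverse $\Sigma^{-1}:\Omega\to\widehat\Gamma$. The map $U_\Sigma:L^2(\Omega,\mu_{CP})\to L^2(\widehat\Gamma,\pi_{\widehat\sigma})$, $U_\Sigma h=h\circ\Sigma$, is unitary with inverse $U_\Sigma^{-1}\widehat f=\widehat f\circ\Sigma^{-1}$. $\mathcal{F}C_b^\infty(\mathcal{D},\Omega)$ is the set of functions $h(\omega)=H(\langle\omega,\varphi_1\rangle,\dots,\langle\omega,\varphi_N\rangle)$ with $\varphi_1,\dots,\varphi_N\in\mathcal{D}$ and $H\in C_b^\infty(\mathbb{R}^N)$ ($C^\infty$-functions with bounded derivatives). The operator $\nabla^{P}_{\widehat\varphi}$ (annihilation operator on the Poisson space $L^2(\pi_{\widehat\sigma})$) acts on smooth cylinder functions $\widehat f$ on $\widehat\Gamma$, in particular on $\widehat f=U_\Sigma h$, by $(\nabla^{P}_{\widehat\varphi}\widehat f)(\widehat\gamma)=\int_{\mathbb{R}^{d+1}}\big(\widehat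 f(\widehat\gamma+\varepsilon_{\widehat x})-\widehat f(\widehat\gamma)\big)\widehat\varphi(\widehat x)\,d\widehat\sigma(\widehat x)$. *)

(* Defs.v *)
From HB Require Import structures.
From mathcomp Require Import all_boot all_order all_algebra.
From mathcomp Require Import all_classical all_reals all_analysis.

Set Implicit Arguments.
Unset Strict Implicit.
Unset Printing Implicit Defensive.
Import Order.TTheory GRing.Theory Num.Theory.
Import numFieldNormedType.Exports.
Local Open Scope classical_set_scope.
Local Open Scope ring_scope.

Section SmoothFunctions.
Context {R : realType} {V : normedModType R}.

Definition iter_derive (vs : seq V) (f : V -> R^o) : V -> R^o :=
  foldr (fun v g => 'D_v g) f vs.

(* On a finite-dimensional V this is C^oo: all iterated directional
   derivatives exist and are continuous. *)
Definition smooth (f : V -> R^o) : Prop :=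
  forall vs : seq V,
    continuous (iter_derive vs f) /\
    forall x v, derivable (iter_derive vs f) x v.

(* Only the derivatives of order >= 1 are required to be bounded, so bounded
   functions with bounded derivatives are covered as well. *)
Definition Cb_smooth (f : V -> R^o) : Prop :=
  smooth f /\
  forall vs : seq V, vs != [::] ->
    exists C : R, forall x, `|iter_derive vs f x| <= C.

End SmoothFunctions.

Record testfun (R : realType) (V : normedModType R) := TestFun {
  testfun_fun :> V -> R^o ;
  testfun_smooth : smooth testfun_fun ;
  testfun_compact : compact (closure [set x | testfun_fun x != 0]) }.

Section Distributions.
Context {R : realType} {V : normedModType R}.
Implicit Types (T : testfun V -> R).

(* Linearity for the pointwise operations of C_0^oo; testfun carries no module
   structure, hence the third test function chi = a *: phi + psi. *)
Definition dist_linear T : Prop :=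
  forall (a : R) (phi psi chi : testfun V),
    (forall x, chi x = a * phi x + psi x) -> T chi = a * T phi + T psi.

(* Continuity for the inductive limit topology of C_0^oo: on test functions
   supported in a compact K, T is dominated by finitely many derivatives. *)
Definition dist_continuous T : Prop :=
  forall K : set V, compact K ->
    exists (n : nat) (C : R), forall (phi : testfun V) (M : R),
      [set x | phi x != 0] `<=` K ->
      (forall vs : seq V, (size vs <= n)%N -> (forall v, v \in vs -> `|v| <= 1) ->
         forall x, `|iter_derive vs phi x| <= M) ->
      `|T phi| <= C * M.

Definition is_distribution T : Prop := dist_linear T /\ dist_continuous T.

End Distributions.

Record schwartz_dist (R : realType) (V : normedModType R) := Distribution {
  dist_fun :> testfun V -> R ;
  distP : is_distribution dist_fun }.

HB.instance Definition _ (R : realType) (V : normedModType R) :=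
  gen_eqMixin (schwartz_dist V).
HB.instance Definition _ (R : realType) (V : normedModType R) :=
  gen_choiceMixin (schwartz_dist V).

Section DistributionSpace.
Context {R : realType} {V : normedModType R}.
Implicit Types (S T : schwartz_dist V).

Lemma dist_ext S T : (forall phi, S phi = T phi) -> S = T.
Proof.
case: S => S hS; case: T => T hT /= /funext eST.
by rewrite eST in hS *; congr Distribution; exact: Prop_irrelevance.
Qed.

Lemma is_distribution0 : is_distribution (fun _ : testfun V => 0 : R).
Proof.
split=> [a phi psi chi _|K _]; first by rewrite mulr0 addr0.
by exists 0%N, 0 => phi M _ _; rewrite mul0r normr0.
Qed.

Lemma is_distributionD S T : is_distribution (fun phi => S phi + T phi).
Proof.
case: (distP S) => lS cS; case: (distP T) => lT cT; split.
  move=> a phi psi chi e; rewrite (lS _ _ _ _ e) (lT _ _ _ _ e).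
  by rewrite mulrDr addrACA.
move=> K cK; have [n [C hC]] := cS K cK; have [m [D hD]] := cT K cK.
exists (maxn n m), (C + D) => phi M sK hM.
rewrite mulrDl (le_trans (ler_normD _ _))// lerD//.
  by apply: hC => // vs nvs; apply: hM; rewrite (leq_trans nvs)// leq_maxl.
by apply: hD => // vs nvs; apply: hM; rewrite (leq_trans nvs)// leq_maxr.
Qed.

Lemma is_distributionZ (a : R) T : is_distribution (fun phi => a * T phi).
Proof.
case: (distP T) => lT cT; split.
  by move=> b phi psi chi e; rewrite (lT _ _ _ _ e) mulrDr mulrCA.
move=> K cK; have [n [C hC]] := cT K cK.
exists n, (`|a| * C) => phi M sK hM.
by rewrite normrM -mulrA ler_wpM2l//; exact: hC.
Qed.

Lemma is_distribution_delta (x : V) : is_distribution (fun phi : testfun V => phi x).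
Proof.
split=> [a phi psi chi ->//|K _]; exists 0%N, 1 => phi M _ hM.
by rewrite mul1r; exact: (hM [::]).
Qed.

Definition dist0 : schwartz_dist V := Distribution is_distribution0.
Definition distD S T : schwartz_dist V := Distribution (is_distributionD S T).
Definition distZ (a : R) T : schwartz_dist V := Distribution (is_distributionZ a T).
Definition distN T : schwartz_dist V := distZ (-1) T.

Lemma distDA : associative distD.
Proof. by move=> S T U; apply: dist_ext => phi /=; rewrite addrA. Qed.
Lemma distDC : commutative distD.
Proof. by move=> S T; apply: dist_ext => phi /=; rewrite addrC. Qed.
Lemma dist0D : left_id dist0 distD.
Proof. by move=> S; apply: dist_ext => phi /=; rewrite add0r. Qed.
Lemma distND : left_inverse dist0 distN distD.
Proof. by move=> S; apply: dist_ext => phi /=; rewrite mulN1r addNr. Qed.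

HB.instance Definition _ :=
  GRing.isZmodule.Build (schwartz_dist V) distDA distDC dist0D distND.

Lemma distZA (a b : R) T : distZ a (distZ b T) = distZ (a * b) T.
Proof. by apply: dist_ext => phi /=; rewrite mulrA. Qed.
Lemma dist1Z : left_id 1 distZ.
Proof. by move=> T; apply: dist_ext => phi /=; rewrite mul1r. Qed.
Lemma distZDr : right_distributive distZ +%R.
Proof. by move=> a S T; apply: dist_ext => phi /=; rewrite mulrDr. Qed.
Lemma distZDl T : {morph distZ^~ T : a b / a + b}.
Proof. by move=> a b; apply: dist_ext => phi /=; rewrite mulrDl. Qed.

HB.instance Definition _ := GRing.Zmodule_isLmodule.Build R (schwartz_dist V)
  distZA dist1Z distZDr distZDl.
HB.instance Definition _ := isPointed.Build (schwartz_dist V) 0.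

Definition dirac_dist (x : V) : schwartz_dist V := Distribution (is_distribution_delta x).

End DistributionSpace.

Definition borel (T : ptopologicalType) := g_sigma_algebraType (@open T).

(* The cylinder sigma-algebra of D', generated by the maps <., phi>. *)
Definition dist_cylinders (R : realType) (V : normedModType R) :
    set (set (schwartz_dist V)) :=
  [set C | exists (phi : testfun V) (B : set R),
     measurable B /\ C = [set T : schwartz_dist V | B (T phi)]].

Definition distribution_space (R : realType) (V : normedModType R) :=
  g_sigma_algebraType (@dist_cylinders R V).

(* The sum of a real family over an arbitrary index set, as a difference of two
   sums of nonnegative families; meaningful for summable families. *)
Definition rsum (R : realType) (T : choiceType) (A : set T) (f : T -> R) : R :=
  fine (\esum_(i in A) (EFin \o f)^\+%E i) - fine (\esum_(i in A) (EFin \o f)^\-%E i).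

Definition locally_finite (T : topologicalType) (A : set T) : Prop :=
  forall K : set T, compact K -> finite_set (A `&` K).

Definition locally_countable (T : topologicalType) (A : set T) : Prop :=
  forall K : set T, compact K -> countable (A `&` K).

Section MeasureNotions.
Context {d : measure_display} {R : realType}.

Definition nonatomic (T : measurableType d) (mu : {measure set T -> \bar R}) : Prop :=
  ~ exists A : set T, [/\ measurable A, (0 < mu A)%E &
      forall B : set T, measurable B -> B `<=` A -> mu B = 0%E \/ mu B = mu A].

End MeasureNotions.

(* Borel measures on R^d that are finite on compact sets are regular. *)
Definition radon (R : realType) (d : nat)
    (sigma : {measure set (borel 'rV[R]_d) -> \bar R}) : Prop :=
  forall K : set 'rV[R]_d, compact K -> (sigma K < +oo)%E.

Definition msupport (R : realType) (rho : {measure set R -> \bar R}) : set R :=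
  [set s | forall U : set R, open U -> U s -> (0 < rho U)%E].

Section Configurations.
Context {R : realType} {d : nat}.
Notation V := 'rV[R]_d.

(* A point (s, x) of R^{d+1} = R x R^d is a pair; R^o is R as a normed module. *)
Definition point_space := (R^o * V)%type.
Definition config := set point_space.

Variable rho : {sigma_finite_measure set R -> \bar R}.
Variable sigma : {sigma_finite_measure set (borel V) -> \bar R}.

Definition sigma_hat := (rho \x sigma)%E.

(* If rho is infinite, its mass accumulates at 0 and the points of the Poisson
   process accumulate at the hyperplane s = 0 (which is sigma_hat-null); local
   finiteness then refers to the compact sets that do not meet it. *)
Definition Gamma : set config :=
  [set g | forall K : set point_space, compact K ->
     (rho setT = +oo%E -> forall z, K z -> z.1 != 0) -> finite_set (g `&` K)].

Definition Sigma_raw (g : config) (phi : testfun V) : R :=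
  rsum g (fun z => z.1 * phi z.2).

Definition Sigma (g : config) : schwartz_dist V :=
  if pselect (is_distribution (Sigma_raw g)) is left p then Distribution p else 0.

Definition positions_ok (c : set V) : Prop :=
  ((rho setT < +oo)%E -> locally_finite c) /\
  (rho setT = +oo%E -> locally_countable c).

(* Configurations with pairwise distinct positions; the further almost sure
   properties are those that make Sigma g an element of Omega and Sigma
   injective: a mark 0 is invisible in Sigma g. *)
Definition Gamma_hat : set config :=
  [set g | [/\ Gamma g,
    (forall z w, g z -> g w -> z.2 = w.2 -> z = w),
    (forall z, g z -> msupport rho z.1 /\ z.1 != 0),
    positions_ok (snd @` g) &
    forall K : set V, compact K ->
      summable [set z | g z /\ K z.2] (fun z => (z.1)%:E)]].

(* sum_(x in c) s_x eps_x is understood as a signed measure that is finite on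
   compact sets, i.e. the marks are absolutely summable over compact sets. *)
Definition Omega : set (schwartz_dist V) :=
  [set omega | exists (c : set V) (s : V -> R),
    [/\ positions_ok c,
      (forall x, c x -> msupport rho (s x)),
      (forall K : set V, compact K -> summable (c `&` K) (fun x => (s x)%:E)) &
      forall phi : testfun V, omega phi = rsum c (fun x => s x * phi x)]].

Definition Sigma_inv : schwartz_dist V -> config :=
  'pinv_(fun=> set0) Gamma_hat Sigma.

Definition U_Sigma (h : schwartz_dist V -> R) : config -> R := h \o Sigma.

Definition U_Sigma_inv (f : config -> R) : schwartz_dist V -> R := f \o Sigma_inv.

(* g + eps_z is g `|` [set z]: the two agree unless z is already in g. *)
Definition nablaP (phih : testfun point_space) (f : config -> R) : config -> R :=
  fun g => \int[sigma_hat]_z ((f (g `|` [set z]) - f g) * phih z).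

(* Functions on Omega are represented by functions on D' whose values outside
   of Omega are arbitrary. *)
Definition FCb (h : schwartz_dist V -> R) : Prop :=
  exists (N : nat) (phis : 'I_N -> testfun V) (H : 'rV[R]_N -> R^o),
    Cb_smooth H /\
    forall omega, Omega omega -> h omega = H (\row_i (omega (phis i) : R)).

(* The sigma-algebra generated by the counting maps g |-> #(g `&` B). *)
Definition counting_events : set (set config) :=
  [set E | exists (B : set (R * borel V)%type) (n : nat),
     measurable B /\ E = [set g : config | (g `&` B #= `I_n)%card]].

Definition config_space := g_sigma_algebraType counting_events.

(* If sigma_hat is finite on compact sets, the integrability condition holds
   for every psi. *)
Definition is_poisson (pi : probability config_space R) : Prop :=
  {ae pi, forall g, Gamma g} /\
  forall psi : testfun point_space,
    sigma_hat.-integrable setT (fun z => (expR (psi z) - 1)%:E) ->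
    (\int[pi]_(g in Gamma) (expR (rsum g psi))%:E
       = (expR (\int[sigma_hat]_z (expR (psi z) - 1)%R))%:E)%E.

(* Both sides are +oo if s |-> e^{s phi(x)} - 1 is not integrable; the negative
   part always is, by the moment condition. *)
Definition is_compound_poisson (mu : probability (distribution_space V) R) : Prop :=
  forall phi : testfun V,
    (\int[mu]_omega (expR (dist_fun omega phi))%:E
      = expeR (\int[sigma]_x \int[rho]_s (expR (s * phi x) - 1)%:E))%E.

Definition compound_poisson_pair (pi : probability config_space R)
    (mu : probability (distribution_space V) R) : Prop :=
  [/\ is_poisson pi,
    {ae pi, forall g, Gamma_hat g},
    is_compound_poisson mu,
    {ae mu, forall omega, Omega omega} &
    forall B : set (distribution_space V), measurable B ->
      mu B = pi (Gamma_hat `&` Sigma @^-1` B)].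

End Configurations.

(* Main.v *)
Require Import Defs.
From HB Require Import structures.
From mathcomp Require Import all_boot all_order all_algebra.
From mathcomp Require Import all_classical all_reals all_analysis.
From mathcomp Require Import lra measurable_realfun.

(* On Omega the map Sigma has a right inverse, and adding a point (s, x) to a
   configuration of Gamma_hat adds s eps_x to its image, so the integrands of
   the two sides agree outside the points (s, x) with x in a countable set or
   s outside the support of rho; these are null because sigma is non-atomic.
   There the integrand is that of the cylinder representation H of h.  As H is
   Lipschitz it is bounded by C |s| 1_K(x) with K compact, hence integrable by
   the first moment of rho, and Fubini's theorem exchanges the integrals.  The
   values of h outside Omega being arbitrary, the original integrands need not
   be measurable, so almost everywhere equality must be shown to preserve the
   integral without measurability. *)

Set Implicit Arguments.
Unset Strict Implicit.
Unset Printing Implicit Defensive.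
Import Order.TTheory GRing.Theory Num.Theory.
Import numFieldNormedType.Exports.
Local Open Scope classical_set_scope.
Local Open Scope ring_scope.

(** * Sums of real families *)

Section RealSums.
Context {R : realType} {T : choiceType}.
Implicit Types (A B : set T) (f g p q : T -> R).

Lemma esumZl A f (a : R) : 0 <= a ->
  (\esum_(x in A) (a * f x)%:E = a%:E * \esum_(x in A) (f x)%:E)%E.
Proof.
move=> a0; rewrite /esum -ereal_supZl//; last first.
  by apply/set0P; exists 0%E; exists set0; [exact: fsets_set0|rewrite fsbig_set0].
congr ereal_sup; rewrite image_comp; apply: eq_imagel => X [finX XA] /=.
by rewrite !fsumEFin//= -EFinM !fsbig_finite//= mulr_sumr.
Qed.

Lemma summable_le A f g : (forall x, A x -> `|f x| <= `|g x|) ->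
  summable A (EFin \o g) -> summable A (EFin \o f).
Proof. by move=> fg; apply: le_lt_trans; apply: le_esum => x /fg; rewrite lee_fin. Qed.

Lemma summableZ A f (a : R) : summable A (EFin \o f) ->
  summable A (fun x => (a * f x)%:E).
Proof.
rewrite /summable /= => sf.
rewrite (eq_esum (b := fun x => (`|a| * `|f x|)%:E)); last first.
  by move=> x _ /=; rewrite normrM.
by rewrite esumZl// lte_mul_pinfty.
Qed.

Lemma summable_bounded_mul A f g (M : R) : (forall x, A x -> `|g x| <= M) ->
  summable A (EFin \o f) -> summable A (fun x => (f x * g x)%:E).
Proof.
move=> gM sf; apply: (summable_le (g := fun x => M * f x)); last exact: summableZ.
move=> x Ax; rewrite !normrM mulrC ler_wpM2r//.
by rewrite (le_trans (gM _ Ax))// ler_norm.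
Qed.

Lemma summable_fin_num A p : (forall x, A x -> 0 <= p x) ->
  summable A (EFin \o p) -> (\esum_(x in A) (p x)%:E)%E \is a fin_num.
Proof.
move=> p0; rewrite summableE => /eqP; rewrite -(eq_esum (a := EFin \o p)) => [/eqP//|].
by move=> x Ax /=; rewrite ger0_norm// p0.
Qed.

(** Any splitting into nonnegative summable families computes [rsum], not only the one into positive
    and negative parts. Additivity and scaling reduce to this freedom. *)
Lemma rsumE A f p q : (forall x, A x -> f x = p x - q x) ->
  (forall x, A x -> 0 <= p x) -> (forall x, A x -> 0 <= q x) ->
  summable A (EFin \o p) -> summable A (EFin \o q) ->
  rsum A f = fine (\esum_(x in A) (p x)%:E)%E - fine (\esum_(x in A) (q x)%:E)%E.
Proof.
move=> fpq p0 q0 sp sq.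
have spq := summableB sp sq.
have := esumB sp sq p0 q0.
rewrite -(eq_esum (a := (EFin \o f)^\+%E) (b := ((EFin \o p) \- (EFin \o q))%E^\+%E)); last first.
  by move=> x Ax; rewrite !funeposE /= fpq//.
rewrite -(eq_esum (a := (EFin \o f)^\-%E) (b := ((EFin \o p) \- (EFin \o q))%E^\-%E)); last first.
  by move=> x Ax; rewrite !funenegE /= fpq//.
have sf : summable A (EFin \o f).
  apply: le_lt_trans spq; apply: le_esum => x Ax /=.
  by rewrite fpq//.
have fp : (\esum_(i in A) ((EFin \o f)^\+ i))%E \is a fin_num.
  have := summable_funepos sf; rewrite summableE.
  by under eq_esum do rewrite gee0_abs//.
have fn : (\esum_(i in A) ((EFin \o f)^\- i))%E \is a fin_num.
  have := summable_funeneg sf; rewrite summableE.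
  by under eq_esum do rewrite gee0_abs//.
move=> e; rewrite /rsum -fineB// e fineB//; exact: summable_fin_num.
Qed.

Let pos f x := Num.max (f x) 0.
Let neg f x := Num.max (- f x) 0.

Let posneg f x : f x = pos f x - neg f x.
Proof. by rewrite /pos /neg; case: leP => ?; case: leP => ?; lra. Qed.

Let pos0 f x : 0 <= pos f x. Proof. by rewrite /pos le_max lexx orbT. Qed.
Let neg0 f x : 0 <= neg f x. Proof. by rewrite /neg le_max lexx orbT. Qed.

Let summable_pos A f : summable A (EFin \o f) -> summable A (EFin \o pos f).
Proof.
apply: summable_le => x _; rewrite (ger0_norm (pos0 _ _)) /pos.
by rewrite ge_max ler_norm normr_ge0.
Qed.

Let summable_neg A f : summable A (EFin \o f) -> summable A (EFin \o neg f).
Proof.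
apply: summable_le => x _; rewrite (ger0_norm (neg0 _ _)) /neg.
by rewrite ge_max -normrN ler_norm normr_ge0.
Qed.

Let rsum_posneg A f : summable A (EFin \o f) ->
  rsum A f = fine (\esum_(x in A) (pos f x)%:E)%E - fine (\esum_(x in A) (neg f x)%:E)%E.
Proof.
by move=> sf; apply: rsumE => //; [exact: summable_pos|exact: summable_neg].
Qed.

Lemma rsumD A f g : summable A (EFin \o f) -> summable A (EFin \o g) ->
  rsum A (fun x => f x + g x) = rsum A f + rsum A g.
Proof.
move=> sf sg.
(* Positive parts are only subadditive, so this splitting of [f + g] is in general not the canonical
   one. *)
rewrite (rsumE (p := fun x => pos f x + pos g x) (q := fun x => neg f x + neg g x)).
- rewrite !rsum_posneg//.
  under eq_esum do rewrite EFinD.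
  under [X in _ - fine X]eq_esum do rewrite EFinD.
  rewrite !esumD//; do ?by move=> *; rewrite lee_fin.
  rewrite !fineD//; do ?by apply: summable_fin_num => //; exact: summable_pos || exact: summable_neg.
  by rewrite opprD addrACA.
- by move=> x _; rewrite {1}(posneg f) {1}(posneg g) opprD addrACA.
- by move=> *; rewrite addr_ge0.
- by move=> *; rewrite addr_ge0.
- exact: (summableD (summable_pos sf) (summable_pos sg)).
- exact: (summableD (summable_neg sf) (summable_neg sg)).
Qed.

Lemma rsumZ A f (a : R) : summable A (EFin \o f) ->
  rsum A (fun x => a * f x) = a * rsum A f.
Proof.
move=> sf; rewrite (rsum_posneg sf) mulrBr.
have sp := summable_pos sf; have sn := summable_neg sf.
have fp := summable_fin_num (fun x _ => pos0 f x) sp.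
have fn := summable_fin_num (fun x _ => neg0 f x) sn.
have [a0|a0] := leP 0 a.
  rewrite (rsumE (p := fun x => a * pos f x) (q := fun x => a * neg f x)).
  - by rewrite !esumZl// !fineM.
  - by move=> x _; rewrite -mulrBr -posneg.
  - by move=> *; rewrite mulr_ge0.
  - by move=> *; rewrite mulr_ge0.
  - exact: summableZ.
  - exact: summableZ.
have a0' : 0 <= - a by rewrite oppr_ge0 ltW.
(* A negative factor exchanges the roles of the positive and negative parts. *)
rewrite (rsumE (p := fun x => - a * neg f x) (q := fun x => - a * pos f x)).
- by rewrite !esumZl// !fineM//= !mulNr opprK addrC.
- by move=> x _; rewrite {1}(posneg f) !mulNr opprK mulrBr addrC.
- by move=> *; rewrite mulr_ge0.
- by move=> *; rewrite mulr_ge0.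
- exact: summableZ.
- exact: summableZ.
Qed.

Lemma ler_norm_rsum A f : summable A (EFin \o f) ->
  `|rsum A f| <= fine (\esum_(x in A) `|(f x)%:E|)%E.
Proof.
move=> sf; rewrite (rsum_posneg sf).
have sp := summable_pos sf; have sn := summable_neg sf.
have fp := summable_fin_num (fun x _ => pos0 f x) sp.
have fn := summable_fin_num (fun x _ => neg0 f x) sn.
have -> : (\esum_(x in A) `|(f x)%:E| =
  \esum_(x in A) (pos f x)%:E + \esum_(x in A) (neg f x)%:E)%E.
  rewrite -esumD; [|by move=> *; rewrite lee_fin..].
  apply: eq_esum => x _ /=; rewrite -EFinD; congr EFin.
  rewrite /pos /neg; case: (leP (f x) 0) => ?; case: (leP (- f x) 0) => ?;
    by [lra|rewrite ler0_norm//; lra|rewrite ger0_norm//; lra].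
rewrite fineD// (le_trans (ler_normB _ _))// !ger0_norm// fine_ge0//.
all: by apply: esum_ge0 => *; rewrite lee_fin.
Qed.

Lemma eq_rsum A f g : (forall x, A x -> f x = g x) -> rsum A f = rsum A g.
Proof.
move=> fg; rewrite /rsum; congr (fine _ - fine _); apply: eq_esum => x Ax.
  by rewrite !funeposE /= fg.
by rewrite !funenegE /= fg.
Qed.

Lemma rsumU1 A f a : ~ A a -> summable A (EFin \o f) ->
  rsum (A `|` [set a]) f = rsum A f + f a.
Proof.
move=> Aa sf.
(* The nonnegative case serves three times: for [pos f], for [neg f], and for the absolute values
   that give summability. *)
have esumU1 p : (forall x, 0 <= p x) -> (\esum_(x in A `|` [set a]) (p x)%:E =
    \esum_(x in A) (p x)%:E + (p a)%:E)%E.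
  move=> p0; rewrite (esumID A); last by move=> *; rewrite lee_fin.
  congr (_ + _)%E.
    by congr esum; apply/seteqP; split=> [x []//|x Ax]; split=> //; left.
  rewrite (_ : _ `&` _ = [set a]) ?esum_set1 ?lee_fin//.
  by apply/seteqP; split=> [x [[]//]|x ->]; split=> //; right.
have sU p : summable A (EFin \o p) -> summable (A `|` [set a]) (EFin \o p).
  move=> sp; rewrite /summable (eq_esum (b := fun x => (`|p x|)%:E))//.
  by rewrite esumU1// lte_add_pinfty// ltry.
have sp := summable_pos sf; have sn := summable_neg sf.
have fp := summable_fin_num (fun x _ => pos0 f x) sp.
have fn := summable_fin_num (fun x _ => neg0 f x) sn.
rewrite (rsum_posneg sf) (rsum_posneg (sU _ sf)) !esumU1//.
by rewrite !fineD//= (posneg f a) opprD addrACA.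
Qed.

Lemma summable_support A B f : A `<=` B -> (forall x, B x -> ~ A x -> f x = 0) ->
  summable A (EFin \o f) = summable B (EFin \o f).
Proof.
move=> AB f0; rewrite /summable esum_mkcond [in RHS]esum_mkcond; congr (_ < _)%E.
apply: eq_esum => x _; case: ifPn => [/set_mem/AB/mem_set->//|].
rewrite notin_setE => Ax; case: ifPn => // /set_mem Bx /=.
by rewrite f0// normr0.
Qed.

(** This restricts a sum against a test function to the points over a compact set, and discards the
    marks equal to 0. *)
Lemma rsum_support A B f : A `<=` B -> (forall x, B x -> ~ A x -> f x = 0) ->
  rsum A f = rsum B f.
Proof.
move=> AB f0; rewrite /rsum; congr (fine _ - fine _).
  rewrite esum_mkcond [in RHS]esum_mkcond.
  apply: eq_esum => x _; case: ifPn => [/set_mem/AB/mem_set->//|].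
  rewrite notin_setE => Ax; case: ifPn => // /set_mem Bx.
  by rewrite funeposE /= f0// maxxx.
rewrite esum_mkcond [in RHS]esum_mkcond.
apply: eq_esum => x _; case: ifPn => [/set_mem/AB/mem_set->//|].
rewrite notin_setE => Ax; case: ifPn => // /set_mem Bx.
by rewrite funenegE /= f0// oppr0 maxxx.
Qed.

End RealSums.

Lemma rsum_image (R : realType) (T T' : choiceType) (P : set T) (e : T -> T')
    (f : T' -> R) : set_inj P e -> rsum (e @` P) f = rsum P (f \o e).
Proof.
move=> inj_e; rewrite /rsum !esum_image//.
by congr (fine _ - fine _); apply: eq_esum => x _; rewrite ?funeposE ?funenegE.
Qed.

Lemma summable_image (R : realType) (T T' : choiceType) (P : set T) (e : T -> T')
    (f : T' -> \bar R) : set_inj P e -> summable (e @` P) f = summable P (f \o e).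
Proof. by move=> inj_e; rewrite /summable esum_image//. Qed.

(** * Almost everywhere equality and measurability *)

Section AlmostEverywhere.
Import HBNNSimple.
Context d (T : measurableType d) (R : realType).
Variable mu : {measure set T -> \bar R}.
Implicit Types (f g : T -> \bar R) (N : set T).

(* The integral of a nonnegative function is the supremum of the integrals of
   the simple functions below it, so no measurability is needed here. *)
Lemma ge0_le_integral_off_null f g N : measurable N -> mu N = 0%E ->
  (forall x, 0 <= f x)%E -> (forall x, 0 <= g x)%E ->
  (forall x, ~ N x -> f x <= g x)%E ->
  (\int[mu]_x f x <= \int[mu]_x g x)%E.
Proof.
move=> mN muN f0 g0 fg; rewrite !ge0_integralTE//.
apply: ge_ereal_sup => _ [h hf <-].
have mNC : measurable (~` N) by exact: measurableC.
(* The witness is [h] set to 0 on [N]: it stays below [g] everywhere because [g] is nonnegative, and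
   it has the same integral as [h]. *)
apply: ereal_sup_ubound; exists (proj_nnsfun h mNC) => /=.
  move=> x; rewrite mindicE; case: (boolP (x \in ~` N)) => [|_].
    by rewrite inE => Nx; rewrite mulr1 (le_trans (hf x))// fg.
  by rewrite mulr0.
pose k := proj_nnsfun h mNC.
have intE (u : {nnsfun T >-> R}) : sintegral mu u = (\int[mu]_x (u x)%:E)%E.
  by rewrite integral_nnsfun// patch_setT.
rewrite (intE h); transitivity (\int[mu]_x (k x)%:E)%E; first exact: (intE k).
apply: ae_eq_integral => //; [exact/measurable_EFinP..|].
exists N; split=> // x /= /not_implyP[_]; apply: contra_notP => Nx.
by rewrite /k /= mindicE mem_set// mulr1.
Qed.

Lemma ge0_integral_ae_eq f g : (forall x, 0 <= f x)%E -> (forall x, 0 <= g x)%E ->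
  {ae mu, forall x, f x = g x} -> (\int[mu]_x f x = \int[mu]_x g x)%E.
Proof.
move=> f0 g0 [N [mN muN fgN]].
have fg x : ~ N x -> f x = g x by move=> Nx; apply: contra_notP Nx => ?; exact: fgN.
apply/eqP; rewrite eq_le; apply/andP; split;
  by apply: (ge0_le_integral_off_null mN muN) => // x /fg ->.
Qed.

Lemma ae_eq_Rintegral (f g : T -> R) : {ae mu, forall x, f x = g x} ->
  \int[mu]_x f x = \int[mu]_x g x.
Proof.
move=> fg; rewrite /Rintegral integralE [in RHS]integralE; congr (fine (_ - _)%E).
  apply: ge0_integral_ae_eq => //.
  by apply: filterS fg => x fgx; rewrite !funeposE /= fgx.
apply: ge0_integral_ae_eq => //.
by apply: filterS fg => x fgx; rewrite !funenegE /= fgx.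
Qed.

Lemma negligible_countable_bigcup (I : countType) (F : I -> set T) :
  (forall i, mu.-negligible (F i)) -> mu.-negligible (\bigcup_i F i).
Proof.
move=> F0.
have : mu.-negligible (\bigcup_k (if unpickle k is Some i then F i else set0)).
  by apply: negligible_bigcup => k; case: unpickle => //; exact: negligible_set0.
apply: negligibleS => x [i _ Fix]; exists (pickle i) => //.
by rewrite pickleK.
Qed.

Lemma countable_negligible (c : set T) : countable c ->
  (forall x, c x -> mu.-negligible [set x]) -> mu.-negligible c.
Proof.
move=> /countable_injP[f injf] c0.
(* The fibres of the injection [f] cut [c] into pieces of at most one point each. *)
have : mu.-negligible (\bigcup_k [set x | c x /\ f x = k]).
  apply: negligible_bigcup => k.
  have [[x [cx fx]]|no] := pselect (exists x, c x /\ f x = k).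
    apply: negligibleS (c0 x cx) => y [cy fy] /=.
    by apply: injf; rewrite ?inE// fy fx.
  apply: negligibleS (negligible_set0 mu) => y [cy fy] /=.
  by apply: no; exists y.
by apply: negligibleS => x cx; exists (f x).
Qed.

End AlmostEverywhere.

(* Approximating [s] by [floor (n s) / n] makes the function measurable on
   countably many strips; no countable base of the space of [x] is involved. *)
Lemma caratheodory_measurable (R : realType) d (T : measurableType d)
    (f : R -> T -> R) :
  (forall s, measurable_fun setT (f s)) -> (forall x, continuous (f ^~ x)) ->
  measurable_fun setT (fun z : R * T => f z.1 z.2).
Proof.
move=> mf cf.
pose step (n : nat) (k : int) : R := k%:~R / n.+1%:R.
pose fl (n : nat) (s : R) : int := Num.floor (s * n.+1%:R).
pose h n (z : R * T) := f (step n (fl n z.1)) z.2.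
apply: (measurable_fun_cvg (h := h)).
  move=> n _ Y mY; rewrite setTI.
  rewrite (_ : h n @^-1` Y = \bigcup_(k : int)
      ([set` `[step n k, step n (k + 1)[] `*` (f (step n k) @^-1` Y))).
    apply: countable_bigcupT_measurable => // k; apply: measurableX => //.
    by rewrite -[X in measurable X]setTI; exact: mf.
  have flP (s : R) (k : int) : (s \in `[step n k, step n (k + 1)[) = (fl n s == k).
    by rewrite in_itv/= /fl floor_eq /step ler_pdivrMr// ltr_pdivlMr.
  apply/seteqP; split=> [z Yz|z [k _ [/= sk fY]]].
    by exists (fl n z.1) => //; split => //=; rewrite flP.
  by move: sk; rewrite flP /h => /eqP ->.
move=> [s x] _; rewrite /h /=.
apply: (@cvg_comp _ _ _ (fun n => step n (fl n s)) (f ^~ x) _ (nbhs s)); last exact: cf.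
apply/cvgrPdist_lt => e e0.
(* The rounded value lies within 1/(n+1) of [s], so the harmonic sequence controls the error. *)
have := @cvg_harmonic R; move/cvgrPdist_lt => /(_ e e0).
apply: filterS => n; apply: le_lt_trans.
rewrite sub0r normrN [leRHS]ger0_norm ?harmonic_ge0//.
have /andP[h1 h2] := floor_itv (s * n.+1%:R).
rewrite /step /fl ger0_norm; last by rewrite subr_ge0 ler_pdivrMr.
rewrite /harmonic /= lerBlDr -[X in X + _]mul1r -mulrDl ler_pdivlMr// addrC.
by rewrite -[1]/(1%:~R) -intrD ltW.
Qed.

(** Each point outside the support has a null open neighbourhood, hence lies in a null interval with
    rational endpoints, and there are only countably many of these. *)
Lemma msupport_ae (R : realType) (rho : {measure set R -> \bar R}) :
  rho.-negligible (~` msupport rho).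
Proof.
pose F (pq : rat * rat) : set R :=
  if rho [set` `]ratr pq.1, ratr pq.2[] == 0%E then [set` `]ratr pq.1, ratr pq.2[] else set0.
have : rho.-negligible (\bigcup_pq F pq).
  apply: negligible_countable_bigcup => pq; rewrite /F.
  case: eqP => h; last exact: negligible_set0.
  by exists [set` `]ratr pq.1, ratr pq.2[]; split.
apply: negligibleS => s /= ns.
have [U [oU Us rU]] : exists U : set R, [/\ open U, U s & rho U = 0%E].
  apply: contrapT => nU; apply: ns => U oU Us.
  rewrite lt0e measure_ge0 andbT; apply/eqP => rU.
  by apply: nU; exists U.
have [e /= e0 eU] : exists2 e : R, 0 < e & ball s e `<=` U by exact/nbhs_ballP/open_nbhs_nbhs.
have [|p] := @rat_in_itvoo _ (s - e) s; first by rewrite ltrBlDr ltrDl.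
rewrite in_itv/= => /andP[p1 p2].
have [|q] := @rat_in_itvoo _ s (s + e); first by rewrite ltrDl.
rewrite in_itv/= => /andP[q1 q2].
have pqU : [set` `]ratr p, ratr q[] `<=` U.
  move=> t /=; rewrite in_itv/= => /andP[t1 t2]; apply: eU.
  by rewrite /ball/= ltr_norml; lra.
exists (p, q) => //; rewrite /F /= ifT.
  by rewrite /= in_itv/= p2 q1.
apply/eqP/eqP; rewrite eq_le measure_ge0 andbT -rU le_measure// ?inE//.
exact: open_measurable.
Qed.

(** * Borel sets, test functions and Lipschitz bounds *)

Section Borel.
Context {R : realType} {T : ptopologicalType}.

Lemma open_borel (A : set T) : open A -> measurable (A : set (borel T)).
Proof. by move=> oA; exact: sub_sigma_algebra. Qed.

Lemma closed_borel (A : set T) : closed A -> measurable (A : set (borel T)).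
Proof.
move=> cA; rewrite -[A]setCK; apply: measurableC; apply: open_borel.
exact: closed_openC.
Qed.

Lemma continuous_borel (f : T -> R) : continuous f ->
  measurable_fun (setT : set (borel T)) (f : borel T -> R).
Proof.
move=> cf; apply: (measurability _ (RGenOInfty.measurableE R)).
move=> _ [_ [a ->] <-]; rewrite setTI; apply: open_borel.
by apply: open_comp => [x _|]; [exact: cf|exact: interval_open].
Qed.

End Borel.

Lemma compact_borel (R : realType) d (K : set 'rV[R]_d) : compact K ->
  measurable (K : set (borel 'rV[R]_d)).
Proof.
by move=> cK; apply: closed_borel; apply: compact_closed => //; exact: norm_hausdorff.
Qed.

Lemma rV_sigma_compact (R : realType) d : exists K : nat -> set 'rV[R]_d,
  (forall n, compact (K n)) /\ \bigcup_n K n = setT.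
Proof.
exists (fun n => [set v | forall i, [set` `[(- n%:R)%R, n%:R]] (v ord0 i)]); split.
  move=> n; exact: (@rV_compact R d (fun=> [set` `[(- n%:R)%R, n%:R]]) (fun=> @segment_compact _ _ _)).
apply/seteqP; split=> // v _; exists (Num.truncn (\sum_i `|v ord0 i|)).+1 => //= i.
rewrite in_itv/= -ler_norml (le_trans (_ : _ <= \sum_i `|v ord0 i|))//.
  by rewrite (bigD1 i)//= lerDl sumr_ge0.
by rewrite ltW// Num.Theory.truncnS_gt.
Qed.

Lemma locally_countable_countable (R : realType) d (c : set 'rV[R]_d) :
  locally_countable c -> countable c.
Proof.
move=> lc; have [K [cK KT]] := rV_sigma_compact R d.
rewrite -[c]setIT -KT setI_bigcupr.
apply: bigcup_countable; first exact: countableP.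
by move=> n _; exact: lc.
Qed.

Section TestFunctions.
Context {R : realType} {V : normedModType R}.
Implicit Type phi : testfun V.

Lemma testfun_continuous phi : continuous (phi : V -> R).
Proof. by have [] := @testfun_smooth _ _ phi [::]. Qed.

Lemma testfun_bounded phi : exists M : R, forall x, `|phi x| <= M.
Proof.
have : {within closure [set x | phi x != 0], continuous (phi : V -> R)}.
  by apply: continuous_subspaceT; exact: testfun_continuous.
move=> /continuous_compact/(_ (@testfun_compact _ _ phi))/compact_bounded.
(* Boundedness is given only for constants strictly above [M], hence [M + 1]; the maximum with 0
   covers the points where [phi] vanishes, as [M] may be negative. *)
move=> [M [_ hM]]; exists (Num.max (M + 1) 0) => x.
have [->|px] := eqVneq (phi x) 0; first by rewrite normr0 le_max lexx orbT.
rewrite le_max (hM (M + 1)) ?ltrDl//; exists x => //.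
exact: subset_closure.
Qed.

Definition tsupport phi := closure [set x | phi x != 0].

Lemma testfun_out phi x : ~ tsupport phi x -> phi x = 0.
Proof. by move=> nx; apply: contra_notP nx => /eqP px; exact: subset_closure. Qed.

End TestFunctions.

Section Lipschitz.
Context {R : realType}.

(** The mean value theorem applies to the restriction of [f] to the line through [x] in direction
    [v], whose ordinary derivative is the directional derivative of [f]. *)
Lemma derive_bounded_lipschitz (V : normedModType R) (f : V -> R^o) (v : V) (C : R) :
  (forall x, derivable f x v) -> (forall x, `|'D_v f x| <= C) ->
  forall x t, `|f (t *: v + x) - f x| <= C * `|t|.
Proof.
move=> df fC x t.
pose g (s : R) : R := f (s *: v + x).
have dg (s : R) : is_derive s 1 g ('D_v f (s *: v + x)).
  have e : (fun h : R => h^-1 *: ((g \o shift s) (h *: 1) - g s)) =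
      (fun h : R => h^-1 *: ((f \o shift (s *: v + x)) (h *: v) - f (s *: v + x))).
    by apply/funext => h; rewrite /g /= [h *: 1]mulr1 scalerDl addrA.
  have := df (s *: v + x); rewrite /derivable => dfs.
  by apply: DeriveDef; rewrite /derivable /derive e.
have cg : continuous g.
  move=> s; apply: differentiable_continuous; apply/derivable1_diffP.
  exact: (@ex_derive _ _ _ _ _ _ _ (dg s)).
have key (a b : R) : a <= b -> `|g b - g a| <= C * `|b - a|.
  move=> ab; have [//|c _ ->] := MVT_segment ab (fun s _ => dg s).
    exact: continuous_subspaceT.
  by rewrite normrM ler_wpM2r.
rewrite (_ : f x = g 0); last by rewrite /g scale0r add0r.
have [t0|t0] := leP 0 t; first by have := key _ _ t0; rewrite subr0.
by have := key _ _ (ltW t0); rewrite distrC sub0r normrN.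
Qed.

(* Only derivatives in fixed directions are known to be bounded, hence the path
   from [w] to [u] changes one coordinate at a time. *)
Lemma Cb_smooth_lipschitz N (H : 'rV[R]_N -> R^o) : Cb_smooth H ->
  exists C : 'I_N -> R, forall u w : 'rV[R]_N,
    `|H u - H w| <= \sum_i C i * `|u ord0 i - w ord0 i|.
Proof.
move=> [sH bH].
have /choice[C hC] (i : 'I_N) : exists C : R, forall (x : 'rV[R]_N) t,
    `|H (t *: delta_mx 0 i + x) - H x| <= C * `|t|.
  have [C hC] := bH [:: delta_mx 0 i] isT; exists C.
  by apply: derive_bounded_lipschitz => // x; have [_] := sH [::]; exact.
exists C => u w.
(* [z k] has already switched to [u] in the first [k] coordinates, so the increments of [H] along
   [z] telescope to [H u - H w]. *)
pose z k : 'rV[R]_N := \row_i (if (i < k)%N then u ord0 i else w ord0 i).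
have z0 : z 0%N = w by apply/rowP => i; rewrite mxE.
have zN : z N = u by apply/rowP => i; rewrite mxE ltn_ord.
rewrite -z0 -zN -(telescope_sumr (fun k => H (z k)) (leq0n N)) big_mkord.
apply: le_trans (ler_norm_sum _ _ _) _; apply: ler_sum => i _.
rewrite z0 zN (_ : z i.+1 = (u ord0 i - w ord0 i) *: delta_mx 0 i + z i)//.
apply/rowP => j; rewrite !mxE eqxx /= ltnS leq_eqVlt.
case: (eqVneq j i) => [->|ji]; first by rewrite eqxx ltnn /= mulr1 subrK.
by rewrite -val_eqE/= in ji *; rewrite (negbTE ji) /= mulr0 add0r.
Qed.

End Lipschitz.

(** * Distributions given by marked points *)

Section Summable.
Context {R : realType} {T : choiceType}.
Implicit Types (A B : set T) (f : T -> \bar R).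

Lemma summable_sub A B f : A `<=` B -> summable B f -> summable A f.
Proof.
move=> AB; apply: le_lt_trans; apply: ge_ereal_sup => _ [X [finX XA] <-].
apply: ereal_sup_ubound; exists X => //; split=> //.
exact: subset_trans AB.
Qed.

(** For infinite [rho] this yields the finiteness of configurations on compact sets that avoid the
    hyperplane s = 0. *)
Lemma summable_finite_ge A f (e : R) : summable A f -> 0 < e ->
  finite_set [set x | A x /\ (e%:E <= `|f x|)%E].
Proof.
move=> sf e0; apply: contrapT => inf.
have : (\esum_(x in A) `|f x|)%E \is a fin_num by rewrite -summableE.
move=> /fineK; set S := fine _ => eS.
(* [B] has more than [S / e] points, so its terms, each at least [e] in absolute value, already sum
   to more than [S]. *)
have [B BA cB] := infinite_set_fset (Num.truncn (S / e)).+1 inf.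
pose r : seq T := finmap.enum_fset B.
have ur : uniq r by exact: finmap.fset_uniq.
have rA x : x \in r -> A x /\ (e%:E <= `|f x|)%E by exact: BA.
have : (S%:E < \sum_(x <- r) e%:E)%E.
  rewrite sumEFin lte_fin big_const_seq count_predT iter_addr_0.
  rewrite -[e *+ _]mulr_natr mulrC -ltr_pdivrMr//.
  by rewrite (lt_le_trans (Num.Theory.truncnS_gt _))// ler_nat cB.
apply/negP; rewrite -leNgt eS; apply: (@le_trans _ _ (\sum_(x <- r) `|f x|)%E).
  by rewrite big_seq [leRHS]big_seq; apply: lee_sum => x /rA[].
rewrite fsbig_seq//.
by apply: esum_ge; exists [set` r] => //; split=> [|x /rA[]].
Qed.

End Summable.

Section MarkedPoints.
Context {R : realType} {V : normedModType R} {I : choiceType}.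
Variables (A : set I) (m : I -> R) (p : I -> V).
Hypothesis summable_m : forall K : set V, compact K ->
  summable (A `&` p @^-1` K) (fun i => (m i)%:E).

(** Only points over the compact support of [phi] contribute; there [phi] is bounded and the marks
    are summable. The map [p] allows both configurations ([p = snd]) and elements of [Omega]
    ([p = id]). *)
Lemma marked_summable (phi : testfun V) :
  summable A (fun i => (m i * phi (p i))%:E).
Proof.
rewrite -[X in summable _ X]/(EFin \o (fun i => m i * phi (p i))).
rewrite -(@summable_support _ _ (A `&` p @^-1` tsupport phi)); first last.
- by move=> i Ai nK; rewrite (testfun_out (x := p i)) ?mulr0// => Ki; exact: nK.
- exact: subIsetl.
have [M hM] := testfun_bounded phi.
apply: summable_bounded_mul => [i _|]; first exact: hM.
exact/summable_m/(@testfun_compact _ _ phi).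
Qed.

Lemma marked_distribution :
  is_distribution (fun phi : testfun V => rsum A (fun i => m i * phi (p i))).
Proof.
split=> [a phi psi chi e|K cK].
  rewrite (eq_rsum (g := fun i => a * (m i * phi (p i)) + m i * psi (p i))).
    rewrite rsumD ?rsumZ//; [exact: marked_summable| |exact: marked_summable].
    exact: (summableZ a (marked_summable phi)).
  by move=> i _; rewrite e mulrDr mulrCA.
(* The distribution has order 0: on test functions supported in [K] it is bounded by the total
   absolute mark over [K] times the sup norm. *)
exists 0%N, (fine (\esum_(i in A `&` p @^-1` K) `|(m i)%:E|)%E) => phi M sK hM.
have phiM x : `|phi x| <= M by exact: (hM [::]).
have M0 : 0 <= M by exact: le_trans (phiM 0).
rewrite -(@rsum_support _ _ (A `&` p @^-1` K)); first last.
- move=> i Ai nK; apply/eqP; rewrite mulf_eq0; apply/orP; right.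
  by apply: contra_notT nK => /sK Ki; split.
- exact: subIsetl.
have sm := summable_m cK.
have smphi : summable (A `&` p @^-1` K) (fun i => (m i * phi (p i))%:E).
  exact: (summable_bounded_mul (fun i _ => phiM (p i))).
apply: le_trans (ler_norm_rsum smphi) _.
have fm : (\esum_(i in A `&` p @^-1` K) `|(m i)%:E|)%E \is a fin_num.
  by rewrite -summableE.
rewrite mulrC -[X in _ <= X]/(fine (M * _)%:E) EFinM fineK//.
rewrite -(esumZl _ (fun i => `|m i|))// fine_le//.
- by rewrite -summableE.
- by rewrite esumZl// fin_numM.
- apply: le_esum => i _; rewrite lee_fin normrM mulrC.
  by rewrite ler_wpM2r.
Qed.

End MarkedPoints.

(** * Configurations *)

Section Configurations.
Context {R : realType} {d : nat}.
Notation V := 'rV[R]_d.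
Variable rho : {sigma_finite_measure set R -> \bar R}.
Implicit Types (g : @config R d) (omega : schwartz_dist V).

Lemma positions_ok_sub (c c' : set V) : c' `<=` c ->
  positions_ok rho c -> positions_ok rho c'.
Proof.
move=> cc' [lf lc]; split=> [h K cK|h K cK].
  by apply: sub_finite_set (lf h K cK); exact: setSI.
by apply: sub_countable (lc h K cK); apply: subset_card_le; exact: setSI.
Qed.

Lemma positions_okU1 (c : set V) x : positions_ok rho c ->
  positions_ok rho (c `|` [set x]).
Proof.
move=> [lf lc]; split=> h K cK; rewrite setIUl.
  by rewrite finite_setU; split; [exact: lf|exact: finite_setIl].
rewrite -bigcup2E; apply: bigcup_countable; first exact: countableP.
move=> [|[|n]] _ /=; [exact: lc| |exact: countable0].
by apply: finite_set_countable; exact: finite_setIl.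
Qed.

Lemma positions_ok_countable (c : set V) : positions_ok rho c -> countable c.
Proof.
move=> [lf lc]; apply: locally_countable_countable => K cK.
have [h|h] := ltP (rho setT) +oo%E; first exact/finite_set_countable/lf.
by apply: lc => //; apply/eqP; rewrite -leye_eq.
Qed.

(** The default value 0 of [Sigma] is not taken on [Gamma_hat], whose last clause is the summability
    that makes the raw sum a distribution. *)
Lemma Sigma_rawE g : Gamma_hat rho g -> Sigma g = Sigma_raw g :> (_ -> _).
Proof.
move=> [_ _ _ _ sg]; rewrite /Sigma; case: pselect => // nd; exfalso; apply: nd.
exact: (marked_distribution (A := g) (m := fst) (p := snd) sg).
Qed.

(** The enlarged configuration may leave [Gamma_hat], for instance if [z] repeats a position. Hence
    the raw sum is computed first; being a sum of two distributions, it excludes the default value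
    of [Sigma]. *)
Lemma Sigma_setU1 g z : Gamma_hat rho g -> ~ g z ->
  Sigma (g `|` [set z]) = Sigma g + (z.1 : R) *: dirac_dist z.2.
Proof.
move=> hg nz.
have e : Sigma_raw (g `|` [set z]) = Sigma g + (z.1 : R) *: dirac_dist z.2 :> (_ -> _).
  apply/funext => phi /=; rewrite /Sigma_raw rsumU1//; first by rewrite (Sigma_rawE hg).
  by have [_ _ _ _ sg] := hg; exact: (marked_summable (A := g) (m := fst) (p := snd) sg).
apply: dist_ext => phi; rewrite {1}/Sigma; case: pselect => [p|nd].
  by rewrite /= e.
by exfalso; apply: nd; rewrite e; exact: distP.
Qed.

(** The marks of the points of [K] form a compact, hence closed, set that misses 0. *)
Lemma compact_away0 (K : set (@point_space R d)) : compact K ->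
  (forall z, K z -> z.1 != 0) ->
  exists2 e : R, 0 < e & forall z, K z -> e <= `|(z.1 : R)|.
Proof.
move=> cK K0.
have c1 : compact (fst @` K).
  by apply: continuous_compact => //; apply: continuous_subspaceT => z; exact: cvg_fst.
have o1 : open (~` (fst @` K)).
  by apply: closed_openC; apply: compact_closed c1; exact: norm_hausdorff.
have : nbhs (0 : R^o) (~` (fst @` K)).
  by apply: open_nbhs_nbhs; split=> // -[z Kz z0]; move: (K0 z Kz); rewrite z0 eqxx.
move=> /nbhs_ballP[e /= e0 eK]; exists e => // z Kz.
rewrite leNgt; apply/negP => ze; apply: (eK z.1); last by exists z.
by rewrite /ball /= sub0r normrN.
Qed.

(* Points with mark 0 are dropped: they do not contribute to the sum. *)
Lemma Sigma_surj omega : Omega rho omega ->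
  exists2 g, Gamma_hat rho g & Sigma g = omega.
Proof.
move=> [c [s [cok sc sumc omegaE]]].
pose P := [set x | c x /\ s x != 0].
pose e (x : V) : @point_space R d := (s x, x).
have inj_e : set_inj P e by move=> x y _ _ [].
have Pc : P `<=` c by move=> x [].
have posE : snd @` (e @` P) = P.
  by apply/seteqP; split=> [_ [_ [x Px <-] <-]//|x Px]; exists (e x) => //; exists x.
have hg : Gamma_hat rho (e @` P).
  split.
  - move=> K cK rooK.
    have cK2 : compact (snd @` K).
      apply: continuous_compact => //.
      by apply: continuous_subspaceT => z; exact: cvg_snd.
    apply: (@sub_finite_set _ _ (e @` (P `&` e @^-1` K))).
      by move=> _ [[x Px <-] Kx]; exists x.
    apply: finite_image.
    have [h|h] := ltP (rho setT) +oo%E.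
      apply: sub_finite_set (cok.1 h _ cK2) => x [[cx sx] Kx].
      by split=> //; exists (e x).
    have roo : rho setT = +oo%E by apply/eqP; rewrite -leye_eq.
    (* For infinite [rho] the positions are only locally countable; finiteness comes from the marks,
       which are at least [eps] in absolute value on [K] and summable over its projection. *)
    have [eps eps0 hK] := compact_away0 cK (rooK roo).
    apply: sub_finite_set (summable_finite_ge (sumc _ cK2) eps0) => x [[cx sx] Kx].
    split; first by split=> //; exists (e x).
    by rewrite /= lee_fin; exact: (hK (e x)).
  - by move=> _ _ [x Px <-] [y Py <-] /= ->.
  - by move=> _ [x [cx sx] <-]; split => //; exact: sc.
  - by rewrite posE; exact: positions_ok_sub cok.
  - move=> K cK.
    apply: (@summable_sub _ _ _ (e @` (P `&` K))).
      by move=> _ [[x Px <-] Kx]; exists x.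
    rewrite summable_image; last by move=> x y _ _ [].
    by apply: summable_sub (sumc K cK); exact: setSI.
exists (e @` P) => //; apply: dist_ext => phi.
rewrite (Sigma_rawE hg) omegaE /Sigma_raw rsum_image//.
apply: rsum_support => // x cx nPx /=.
have [->|sx] := eqVneq (s x) 0; first by rewrite mul0r.
by exfalso; apply: nPx.
Qed.

(** The exceptional set consists of the positions of [omega]: at such a position the marks would add
    up, and their sum may leave the support of [rho]. *)
Lemma Omega_add_dirac omega : Omega rho omega -> exists2 c : set V, countable c &
  forall s x, msupport rho s -> ~ c x -> Omega rho (omega + s *: dirac_dist x).
Proof.
move=> [c [s [cok sc sumc omegaE]]].
exists c; first exact: positions_ok_countable.
move=> t x st ncx.
pose s' y := if y == x then t else s y.
have s'c y : c y -> s' y = s y by rewrite /s'; case: eqP => // -> /ncx.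
exists (c `|` [set x]), s'; split.
- exact: positions_okU1.
- by move=> y [cy|->]; [rewrite s'c//; exact: sc|rewrite /s' eqxx].
- move=> K cK; apply: (@summable_sub _ _ _ ((c `&` K) `|` [set x])).
    by move=> y [[cy|->] Ky]; [left|right].
  rewrite /summable (esumID [set x])//.
  rewrite lte_add_pinfty//.
    rewrite (_ : _ `&` [set x] = [set x]) ?esum_set1 ?abse_ge0 ?ltry//.
    by apply/seteqP; split=> [y []//|y ->]; split=> //; right.
  apply: le_lt_trans (sumc K cK).
  apply: (@le_trans _ _ (\esum_(y in c `&` K) `|(s' y)%:E|)%E); last first.
    by apply: le_esum => y [cy _]; rewrite s'c.
  apply: ge_ereal_sup => _ [X [finX XA] <-].
  apply: ereal_sup_ubound; exists X => //; split=> //.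
  by move=> y /XA[[//|->] /(_ erefl)].
- move=> phi; rewrite rsumU1//.
    rewrite /= omegaE {2}/s' eqxx; congr (_ + _).
    by apply: eq_rsum => y cy; rewrite s'c.
  have := marked_summable (A := c) (m := s) (p := id) sumc phi.
  by apply: summable_le => y cy; rewrite s'c.
Qed.

End Configurations.

(** * The integrand *)

Lemma continuous_row (R : realType) (T : topologicalType) N (b : T -> 'I_N -> R) :
  (forall i, continuous (b ^~ i)) -> continuous (fun x => \row_i b x i : 'rV[R]_N).
Proof.
move=> cb x A [P hP PA].
have : \forall y \near x, forall i, P ord0 i (b y i).
  by apply: filter_forall => i; apply: cb; have := hP ord0 i; rewrite mxE.
by apply: filterS => y hy; apply: PA => i j; rewrite (ord1 i) mxE.
Qed.

(** A singleton of positive measure would be an atom, its only subsets being itself and the empty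
    set. *)
Lemma nonatomic_set1 (R : realType) d (sigma : {measure set (borel 'rV[R]_d) -> \bar R}) x :
  nonatomic sigma -> sigma [set x] = 0%E.
Proof.
move=> na; have mx : measurable ([set x] : set (borel 'rV[R]_d)).
  by apply: compact_borel; exact: compact_set1.
apply: contrapT => /eqP sx; apply: na; exists [set x]; split => //.
  by rewrite lt0e sx measure_ge0.
by move=> B _ /subset_set1[] ->; [left; rewrite measure0|right].
Qed.

Section ProductNegligible.
Context d1 d2 (T1 : measurableType d1) (T2 : measurableType d2) (R : realType).
Variables (m1 : {sigma_finite_measure set T1 -> \bar R}).
Variables (m2 : {sigma_finite_measure set T2 -> \bar R}).

Lemma negligible_prodl (A : set T1) : m1.-negligible A ->
  (m1 \x m2)%E.-negligible (fst @^-1` A : set (T1 * T2)).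
Proof.
move=> [N [mN N0 AN]]; exists (N `*` setT); split.
- exact: measurableX.
(* The other factor may have infinite measure; the convention that 0 times infinity is 0 applies. *)
- by rewrite product_measure1E// (_ : _ N = 0%E) ?mul0e//; exact: N0.
- by move=> z Az; split=> //; exact: AN.
Qed.

Lemma negligible_prodr (A : set T2) : m2.-negligible A ->
  (m1 \x m2)%E.-negligible (snd @^-1` A : set (T1 * T2)).
Proof.
move=> [N [mN N0 AN]]; exists (setT `*` N); split.
- exact: measurableX.
- by rewrite product_measure1E// N0 mule0.
- by move=> z Az; split=> //; exact: AN.
Qed.

End ProductNegligible.

Section Integrand.
Context {R : realType} {d N : nat}.
Notation V := 'rV[R]_d.
Variable rho : {sigma_finite_measure set R -> \bar R}.
Variable sigma : {sigma_finite_measure set (borel V) -> \bar R}.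
Hypothesis rho_moment : (\int[rho]_s (`|s|)%:E < +oo)%E.
Hypothesis sigma_radon : radon sigma.
Variables (phih : testfun (@point_space R d)) (phis : 'I_N -> testfun V).
Variables (H : 'rV[R]_N -> R^o) (a : 'I_N -> R).
Hypothesis HCb : Cb_smooth H.

(** With [a i] the pairing of omega with [phis i], the first row holds the pairings of omega + s
    eps_x. Unlike the integrand written with [h], this one is measurable on the whole product. *)
Definition difference_integrand (s : R) (x : borel V) : R :=
  (H (\row_i (a i + s * phis i x)) - H (\row_i a i)) * phih (s, x).
Local Notation F := difference_integrand.

Let H_continuous : continuous H.
Proof. by have [] := HCb.1 [::]. Qed.

Let phih_continuous : continuous (phih : R^o * V -> R^o).
Proof. exact: testfun_continuous. Qed.

Let phih_continuousr s : continuous (fun x : V => phih (s, x) : R).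
Proof.
move=> x; apply: (@cvg_comp _ _ _ (fun y : V => (s, y)) phih _ (nbhs ((s, x) : R^o * V))).
  exact: (cvg_pair (G := nbhs (s : R^o)) (H := nbhs x) (cvg_cst _) cvg_id).
exact: phih_continuous.
Qed.

Let phih_continuousl x : continuous (fun s : R => phih (s, x) : R).
Proof.
move=> s.
apply: (@cvg_comp _ _ _ (fun t : R => (t, x)) phih _ (nbhs ((s : R^o, x) : R^o * V))).
  exact: (cvg_pair (G := nbhs (s : R^o)) (H := nbhs x) cvg_id (cvg_cst _)).
exact: phih_continuous.
Qed.

(** Letting both [u] and [v] vary covers the integrand as a function of [x] for fixed [s] and as a
    function of [s] for fixed [x]. *)
Let continuous_increment (T : topologicalType) (u k : T -> R) (v : T -> 'I_N -> R) :
  continuous u -> (forall i, continuous (v ^~ i)) -> continuous k ->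
  continuous (fun x => (H (\row_i (a i + u x * v x i)) - H (\row_i a i)) * k x).
Proof.
move=> cu cv ck x; apply: cvgM; last exact: ck.
apply: (@cvgB _ R^o); last exact: cvg_cst.
have cb i : continuous (fun y => a i + u y * v y i).
  move=> y; apply: (@cvgD _ R^o); first exact: cvg_cst.
  by apply: cvgM; [exact: cu|exact: cv].
by apply: (cvg_comp _ _ (continuous_row cb (x := x))); exact: H_continuous.
Qed.

Lemma measurable_difference_integrand :
  measurable_fun setT (fun z : R * borel V => F z.1 z.2).
Proof.
apply: caratheodory_measurable => [s|x].
  apply: continuous_borel.
  apply: (continuous_increment (u := fun=> s) (v := fun y i => phis i y)).
  - exact: cst_continuous.
  - by move=> i; exact: testfun_continuous.
  - exact: phih_continuousr.
apply: (continuous_increment (u := id) (v := fun _ i => phis i x)).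
- by move=> y; exact: cvg_id.
- by move=> i; exact: cst_continuous.
- exact: phih_continuousl.
Qed.

Let K : set V := snd @` tsupport phih.

Let compact_K : compact K.
Proof.
apply: continuous_compact; last exact: testfun_compact.
by apply: continuous_subspaceT => z; exact: cvg_snd.
Qed.

Let indic0 x : 0 <= \1_K x :> R.
Proof. by rewrite indicE ler0n. Qed.

Lemma difference_integrand_bound : exists2 C : R, 0 <= C &
  forall s x, `|F s x| <= C * \1_K x * `|s|.
Proof.
have [M hM] := testfun_bounded phih.
have /choice[B hB] i : exists B : R, forall x, `|phis i x| <= B.
  exact: testfun_bounded.
have [L hL] := Cb_smooth_lipschitz HCb.
(* [L] is the Lipschitz constant per coordinate, [B] bounds the [phis] and [M] bounds [phih];
   absolute values make the product nonnegative at once. *)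
exists ((\sum_i `|L i| * `|B i|) * `|M|).
  by rewrite mulr_ge0// sumr_ge0// => i _; rewrite mulr_ge0.
move=> s x; rewrite /F normrM indicE.
case: (boolP (x \in K)) => [_|]; last first.
  rewrite notin_setE => nK; rewrite (@testfun_out _ _ phih (s, x)).
    by rewrite normr0 !mulr0 mul0r.
  by move=> Kx; apply: nK; exists (s, x).
rewrite mulr1 mulrAC ler_pM//; last by rewrite (le_trans (hM _))// ler_norm.
apply: le_trans (hL _ _) _; rewrite mulr_suml; apply: ler_sum => i _.
rewrite !mxE addrAC subrr add0r normrM [`|s| * _]mulrC mulrA.
rewrite ler_wpM2r//; apply: (@le_trans _ _ (`|L i| * `|phis i x|)).
  by rewrite ler_wpM2r// ler_norm.
by rewrite ler_wpM2l// (le_trans (hB _ _))// ler_norm.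
Qed.

Let measurable_F_s x : measurable_fun setT (F ^~ x).
Proof.
exact: (measurableT_comp measurable_difference_integrand (measurable_pair2 x)).
Qed.

Lemma integrable_difference_integrand_mark x :
  rho.-integrable setT (fun s => (F s x)%:E).
Proof.
have [C C0 hC] := difference_integrand_bound.
apply: (@le_integrable _ _ _ rho setT measurableT (fun s => (F s x)%:E)
  (fun s => (C * \1_K x)%:E * (`|s|)%:E)%E).
- exact/measurable_EFinP.
- move=> s _; rewrite -EFinM /= lee_fin (le_trans (hC s x))//.
  exact: ler_norm.
- apply: (@integrableZl _ _ R rho setT measurableT _ (fun s => (`|s|)%:E)); apply/integrableP; split.
    by apply/measurable_EFinP; exact: normr_measurable.
  by under eq_integral do rewrite gee0_abs ?lee_fin//.
Qed.

(** Integrating the bound over [rho] leaves a multiple of the indicator of [K], and [sigma K] is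
    finite by the Radon property. *)
Lemma integrable_difference_integrand :
  (rho \x sigma)%E.-integrable setT (fun z : R * borel V => (F z.1 z.2)%:E).
Proof.
have [C C0 hC] := difference_integrand_bound.
have mF : measurable_fun setT (fun z : R * borel V => (F z.1 z.2)%:E).
  by apply/measurable_EFinP; exact: measurable_difference_integrand.
apply: (integrable21ltyP rho sigma mF).2.
have mK : measurable (K : set (borel V)) by exact: compact_borel.
set m := (\int[rho]_s (`|s|)%:E)%E.
have m0 : (0 <= m)%E by apply: integral_ge0 => s _; rewrite lee_fin.
have mfin : m \is a fin_num by rewrite ge0_fin_numE.
apply: (@le_lt_trans _ _ (\int[sigma]_x (C * fine m * \1_K x)%:E)%E).
  (* With an empty exceptional set this is monotonicity of the integral, free of measurability
     conditions. *)
  apply: (@ge0_le_integral_off_null _ _ _ _ _ _ set0) => // x.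
  - by apply: integral_ge0.
  - by rewrite lee_fin !mulr_ge0// fine_ge0.
  move=> _; apply: (@le_trans _ _ (\int[rho]_s ((C * \1_K x)%:E * (`|s|)%:E))%E).
    apply: (@ge0_le_integral_off_null _ _ _ _ _ _ set0) => // s.
    - by rewrite -EFinM lee_fin !mulr_ge0// indic0.
    - by move=> _; rewrite -EFinM /= lee_fin.
  rewrite ge0_integralZl_EFin//; last 2 first.
  - by apply/measurable_EFinP; exact: normr_measurable.
  - by rewrite mulr_ge0// indic0.
  by rewrite -/m -[in X in (X <= _)%E](fineK mfin) -EFinM mulrAC.
under eq_integral do rewrite EFinM.
rewrite ge0_integralZl_EFin//; last 2 first.
- exact/measurable_EFinP.
- by rewrite mulr_ge0// fine_ge0.
rewrite integral_indic// setIT lte_mul_pinfty//.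
- by rewrite lee_fin mulr_ge0// fine_ge0.
- exact: sigma_radon.
Qed.

Lemma Rintegral_difference_integrand :
  Rintegral (rho \x sigma)%E setT (fun z => F z.1 z.2) =
  \int[sigma]_x \int[rho]_s F s x.
Proof.
rewrite /Rintegral; congr fine.
rewrite -(fubini2 integrable_difference_integrand); apply: eq_integral => x _.
(* The inner integral is finite for every [x], so passing to its real value loses nothing. *)
rewrite /fubini_G fineK//; apply: integrable_fin_num => //.
exact: integrable_difference_integrand_mark.
Qed.

End Integrand.

(** * The formula on [Omega] and almost everywhere *)

Theorem proposition3p9 (R : realType) (d : nat)
    (rho : {sigma_finite_measure set R -> \bar R})
    (sigma : {sigma_finite_measure set (borel 'rV[R]_d) -> \bar R})
    (rho_moments : forall n : nat, (1 <= n)%N ->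
       (\int[rho]_s (`|s| ^+ n)%:E < +oo)%E)
    (rho0 : rho [set 0] = 0%E)
    (sigma_radon : radon sigma)
    (sigma_nonatomic : nonatomic sigma)
    (phih : testfun (@point_space R d))
    (h : schwartz_dist 'rV[R]_d -> R) (hFCb : FCb rho h) :
  let lhs := U_Sigma_inv rho (nablaP rho sigma phih (U_Sigma h)) in
  let rhs := fun omega : schwartz_dist 'rV[R]_d =>
    \int[sigma]_x \int[rho]_s
      ((h (omega + s *: dirac_dist x) - h omega) * phih (s, x)) in
  (forall omega, Omega rho omega -> lhs omega = rhs omega) /\
  (forall pi mu, compound_poisson_pair rho sigma pi mu ->
     {ae mu, forall omega, lhs omega = rhs omega}).
Proof.
move=> lhs rhs.
suff main omega : Omega rho omega -> lhs omega = rhs omega.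
  split=> // pi mu [_ _ _ Om _].
  by apply: negligibleS Om => omega /=; apply: contra_not; exact: main.
move=> Oom.
have surj : set_surj (Gamma_hat rho) (Omega rho) (@Sigma R d).
  by move=> om /Sigma_surj[g hg <-]; exists g.
pose g := Sigma_inv rho omega.
have hg : Gamma_hat rho g.
  by apply: (surjpinv_image_sub (dflt := fun=> set0) surj); exists omega.
have Sg : Sigma g = omega by apply: (surjpK (fun=> set0) surj); rewrite inE.
have [N [phis [H [HCb hE]]]] := hFCb.
have [c countc Oadd] := Omega_add_dirac Oom.
have rho1 : (\int[rho]_s (`|s|)%:E < +oo)%E.
  have := rho_moments 1%N isT.
  by under eq_integral do rewrite expr1.
have sigma_null (A : set 'rV[R]_d) : countable A -> sigma.-negligible A.
  move=> cA; apply: countable_negligible => // x _.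
  exists [set x]; split=> //; last exact: nonatomic_set1.
  by apply: compact_borel; exact: compact_set1.
pose a i := omega (phis i).
pose F := difference_integrand phih phis H a.
have incr s x : msupport rho s -> ~ c x ->
    (h (omega + s *: dirac_dist x) - h omega) * phih (s, x) = F s x.
  by move=> ms ncx; rewrite hE ?hE//; exact: Oadd.
transitivity (Rintegral (rho \x sigma)%E setT (fun z => F z.1 z.2)).
  apply: ae_eq_Rintegral.
  have n1 := negligible_prodl sigma (msupport_ae rho).
  have n2 := negligible_prodr rho (sigma_null _ countc).
  have cg : countable (snd @` g).
    by have [_ _ _ gok _] := hg; exact: positions_ok_countable gok.
  have n3 := negligible_prodr rho (sigma_null _ cg).
  (* Outside [n1] and [n2] the cylinder form of [h] is available at the shifted distribution;
     outside [n3] the point is new to [g], so the union really adds it. *)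
  apply: negligibleS (negligibleU n1 (negligibleU n2 n3)) => -[s x] /=.
  apply: contra_notP => /not_orP[/contrapT ms /not_orP[ncx ngx]].
  have ngz : ~ g (s, x) by move=> gz; apply: ngx; exists (s, x).
  by rewrite -incr// /U_Sigma /= (Sigma_setU1 hg ngz) Sg.
rewrite Rintegral_difference_integrand//.
(* The remaining integral is iterated, so the exceptional sets are removed one variable at a time:
   first in [x], then in [s] for each good [x]. *)
apply/esym/ae_eq_Rintegral.
apply: negligibleS (sigma_null _ countc) => x /=; apply: contra_notP => ncx.
apply: ae_eq_Rintegral.
apply: negligibleS (msupport_ae rho) => s /=; apply: contra_not => ms.
exact: incr.
Qed.
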